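(* Let $X$ be a polyhedral normed space and let $f: X\to X$ be nonexpansive and real analytic with $\operatorname{Fix}(f)\neq\varnothing$. Define $R: X\to X$ by $R(x)=\lim_{k\to\infty}\left(\tfrac12 f+\tfrac12\operatorname{id}\right)^k(x)$ (this limit exists for every $x$ and lies in $\operatorname{Fix}(f)$, and $R$ is a nonexpansive retraction of $X$ onto $\operatorname{Fix}(f)$). Then there is an affine subspace $W\subseteq X$ such that the restriction of $R$ to $W$ is an isometry from $W$ onto $\operatorname{Fix}(f)$.
   Context: A polyhedral normed space is a finite-dimensional real normed space whose closed unit ball has finitely many extreme points (equivalently, the dual unit ball has finitely many extreme points). A map $f: X\to X$ is nonexpansive if $\|f(x)-f(y)\|\le\|x-y\|$ for all $x,y$. Real analytic means that near every point $f$ is given by a convergent power series (for $X=\mathbb{R}^n$: every component of $f$ is real analytic). $\operatorname{Fix}(f)$ is the set of fixed points of $f$; $\operatorname{id}$ is the identity map; $(\tfrac12 f+\tfrac12\operatorname{id})^k$ denotes the $k$-fold composition of the map $x\mapsto \tfrac12 f(x)+\tfrac12 x$. *)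

(* Defs.v *)
From mathcomp Require Import all_boot all_order all_algebra.
From mathcomp Require Import reals.
Set Implicit Arguments. Unset Strict Implicit. Unset Printing Implicit Defensive.
Import Order.TTheory GRing.Theory Num.Theory.
Local Open Scope ring_scope.

Section Defs.
Variables (R : realType) (n : nat).
Notation X := 'rV[R]_n.

Definition is_norm (N : X -> R) : Prop :=
  [/\ forall x, N x = 0 -> x = 0,
      forall (a : R) x, N (a *: x) = `|a| * N x
    & forall x y, N (x + y) <= N x + N y].

Definition unit_ball (N : X -> R) (x : X) : Prop := N x <= 1.

Definition extreme_point (N : X -> R) (x : X) : Prop :=
  unit_ball N x /\
  forall (y z : X) (t : R), unit_ball N y -> unit_ball N z ->
    0 < t < 1 -> x = t *: y + (1 - t) *: z -> y = x /\ z = x.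

Definition polyhedral_norm (N : X -> R) : Prop :=
  is_norm N /\ exists s : seq X, forall x, extreme_point N x -> x \in s.

Definition nonexpansive (N : X -> R) (f : X -> X) : Prop :=
  forall x y, N (f x - f y) <= N (x - y).

Definition monomial (alpha : 'I_n -> nat) (v : X) : R :=
  \prod_(i < n) (v 0 i) ^+ (alpha i).

(* partial sum of the multivariate power series sum_alpha c_alpha (x-a)^alpha
   over all multi-indices alpha of total degree <= d *)
Definition psum (c : ('I_n -> nat) -> R) (a x : X) (d : nat) : R :=
  \sum_(alpha : {ffun 'I_n -> 'I_d.+1} | (\sum_(i < n) (alpha i : nat) <= d)%N)
     c (fun i => alpha i : nat) * monomial (fun i => alpha i : nat) (x - a).

Definition pabssum (c : ('I_n -> nat) -> R) (a x : X) (d : nat) : R :=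
  \sum_(alpha : {ffun 'I_n -> 'I_d.+1} | (\sum_(i < n) (alpha i : nat) <= d)%N)
     `| c (fun i => alpha i : nat) * monomial (fun i => alpha i : nat) (x - a) |.

Definition seq_cvg_to (u : nat -> R) (l : R) : Prop :=
  forall e : R, 0 < e -> exists M : nat, forall k, (M <= k)%N -> `|u k - l| < e.

Definition analytic_at (g : X -> R) (a : X) : Prop :=
  exists r : R, 0 < r /\ exists c : ('I_n -> nat) -> R,
    forall x : X, (forall i, `|x 0 i - a 0 i| < r) ->
      (exists B : R, forall d, pabssum c a x d <= B) /\
      seq_cvg_to (psum c a x) (g x).

Definition real_analytic (f : X -> X) : Prop :=
  forall (j : 'I_n) (a : X), analytic_at (fun x => f x 0 j) a.

Definition Fix (f : X -> X) (x : X) : Prop := f x = x.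

Definition avg_map (f : X -> X) (x : X) : X := 2^-1 *: f x + 2^-1 *: x.

Definition is_limit_retraction (N : X -> R) (f : X -> X) (Rf : X -> X) : Prop :=
  forall x : X, forall e : R, 0 < e ->
    exists M : nat, forall k, (M <= k)%N -> N (iter k (avg_map f) x - Rf x) < e.

Definition affine_subspace (W : X -> Prop) : Prop :=
  forall x y (t : R), W x -> W y -> W (t *: x + (1 - t) *: y).

Definition isometry_onto_Fix (N : X -> R) (f : X -> X) (Rf : X -> X)
    (W : X -> Prop) : Prop :=
  [/\ forall w, W w -> Fix f (Rf w),
      forall w w', W w -> W w' -> N (Rf w - Rf w') = N (w - w')
    & forall z, Fix f z -> exists2 w, W w & Rf w = z].

End Defs.

(* Main.v *)
(** Write N as the maximum of finitely many functionals phi_i, put M = Fix f,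
    and call a set of indices norming for v if it consists of the i with
    phi_i(v) = N(v).  If x and y are in M, then phi_i(f(x + t(y - x))) is affine
    in t on [0, 1] for each i norming y - x, because f is nonexpansive and fixes
    both ends, hence for all real t by analyticity.  Comparing an arbitrary p
    with far away points of such a line shows that f, and so the retraction R,
    preserves the values phi_i(p - x), for i norming the direction, whenever
    these values all agree.  For an inclusion-minimal norming set F arising from
    such a line, phi_i(z - x) is independent of i in F for every z in M.  So, if
    S is the union of the minimal sets, x0 + L (with L the space where phi_i and
    phi_j agree for i, j in a common minimal set) contains M, R preserves phi_i
    on x0 + L for i in S, and N = max over S of phi_i on M - M.
    Hence u |-> R(x0 + u) is a nonexpansive map from (L, max over S) to (X, N)
    that preserves the phi_i with i in S.  Averaging it over translations makes
    it linear, and W is x0 plus the image of the resulting linear map. *)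

Require Import Defs.
From mathcomp Require Import all_boot all_order all_algebra.
From mathcomp Require Import reals.
From mathcomp Require Import boolp classical_sets filter topology.
From mathcomp Require Import normedtype sequences derive.
From mathcomp Require Import ring lra.
Set Implicit Arguments. Unset Strict Implicit. Unset Printing Implicit Defensive.
Import Order.TTheory GRing.Theory Num.Theory.
Import numFieldNormedType.Exports.
Local Open Scope classical_set_scope.
Local Open Scope ring_scope.

(** * Power series in one variable *)

Section OneVariable.
Variable R : realType.
Implicit Types (h : R -> R) (a : R ^nat).

Lemma sum_geom_le2 (x : R) m : 0 <= x -> x <= 2^-1 ->
  \sum_(0 <= j < m) x ^+ j <= 2.
Proof.
move=> x0 x2; elim: m => [|m IH]; first by rewrite big_nil.
rewrite big_nat_recl // expr0.
under eq_bigr do rewrite exprS.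
rewrite -mulr_sumr; nra.
Qed.

(** Strong induction on [k]: once the earlier coefficients vanish, at [s = - (q * x)] the tail
    beyond [a k * s ^+ k] is [O(x ^+ k.+1)], so [a k] is [O(x)]. Only negative [s] occur, as the
    lemma is applied at a supremum. *)
Lemma pseries_eq0_left a (r : R) : 0 < r ->
  (forall s, - r < s -> s < 0 -> series (fun k => a k * s ^+ k) @ \oo --> 0) ->
  forall k, a k = 0.
Proof.
move=> r0 H.
pose q := r / 2.
have q0 : 0 < q by rewrite divr_gt0.
have [B [B0 HB]] : exists B, 0 < B /\ forall k, `|a k| * q ^+ k <= B.
  have : cvgn (series (fun k => a k * (- q) ^+ k)).
    by apply/cvg_ex; exists 0; apply: H; rewrite /q; lra.
  move=> /cvg_series_bounded /pinfty_ex_gt0 [M M0 HM]; exists M; split => // k.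
  have := HM k I; rewrite /= normrM normrX normrN (ger0_norm (ltW q0)); exact.
elim/ltn_ind => k IH.
have key x : 0 < x -> x <= 2^-1 -> `|a k| * q ^+ k <= 2 * B * x.
  move=> x0 x2.
  pose s := - (q * x).
  have sE : `|s| = q * x by rewrite normrN ger0_norm // mulr_ge0 // ltW.
  have dist m : `|series (fun j => a j * s ^+ j) (k.+1 + m)%N - a k * s ^+ k|
      <= B * x ^+ k.+1 * \sum_(0 <= j < m) x ^+ j.
    elim: m => [|m IHm].
      rewrite addn0 /series /= big_nat_recr //= big1_seq ?add0r ?subrr ?normr0.
        by rewrite big_nil mulr0.
      by move=> j /andP[_]; rewrite mem_index_iota => /andP[_ /IH ->]; rewrite mul0r.
    rewrite addnS /series /= (big_nat_recr (k.+1 + m)%N) //= (big_nat_recr m) //= mulrDr.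
    rewrite addrAC; apply: le_trans (ler_normD _ _) _; apply: lerD => //.
    rewrite normrM normrX sE exprMn mulrA -[leRHS]mulrA -exprD.
    by rewrite ler_wpM2r // exprn_ge0 // ltW.
  have dist2 m : `|series (fun j => a j * s ^+ j) (m + k.+1)%N - a k * s ^+ k|
      <= B * x ^+ k.+1 * 2.
    rewrite addnC; apply: le_trans (dist m) _; rewrite ler_wpM2l //.
      by rewrite mulr_ge0 ?exprn_ge0 // ltW.
    by apply: sum_geom_le2 => //; exact: ltW.
  have cv : (fun m => `|series (fun j => a j * s ^+ j) (m + k.+1)%N - a k * s ^+ k|)
      @ \oo --> `|0 - a k * s ^+ k|.
    apply: cvg_norm; apply: cvgB; last exact: cvg_cst.
    by rewrite (cvg_shiftn k.+1 (series _)); apply: H; rewrite /s /q; nra.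
  have : `|0 - a k * s ^+ k| <= B * x ^+ k.+1 * 2.
    rewrite -(cvg_lim _ cv) //; apply: limr_le; first exact: cvgP cv.
    by near=> m; apply: dist2.
  rewrite sub0r normrN normrM normrX sE exprMn exprS => Hle.
  have xk : 0 < x ^+ k by rewrite exprn_gt0.
  rewrite -(ler_pM2r xk); apply: le_trans (le_trans Hle _); last by lra.
  by rewrite mulrA.
apply/eqP; rewrite -normr_le0 leNgt; apply/negP => ak.
have c0 : 0 < `|a k| * q ^+ k by rewrite mulr_gt0 ?exprn_gt0.
set c := `|a k| * q ^+ k in key c0.
pose x := Num.min 2^-1 (c / (4 * B)).
have x0 : 0 < x by rewrite lt_min invr_gt0 ltr0n /= divr_gt0 // mulr_gt0.
have x2 : x <= 2^-1 by rewrite ge_min lexx.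
have := key _ x0 x2.
have : x <= c / (4 * B) by rewrite ge_min lexx orbT.
rewrite ler_pdivlMr ?mulr_gt0 // => h1 h2; nra.
Unshelve. all: by end_near. Qed.

Definition locally_pseries h := forall t0, exists r : R, 0 < r /\ exists a,
  forall t, `|t - t0| < r -> series (fun k => a k * (t - t0) ^+ k) @ \oo --> h t.

Lemma locally_pseriesD h1 h2 : locally_pseries h1 -> locally_pseries h2 ->
  locally_pseries (fun t => h1 t + h2 t).
Proof.
move=> H1 H2 t0; have [r1 [r10 [a1 A1]]] := H1 t0; have [r2 [r20 [a2 A2]]] := H2 t0.
exists (Num.min r1 r2); split; first by rewrite lt_min r10.
exists (fun k => a1 k + a2 k) => t; rewrite lt_min => /andP[/A1 c1 /A2 c2].
have -> : series (fun k => (a1 k + a2 k) * (t - t0) ^+ k) =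
  series (fun k => a1 k * (t - t0) ^+ k) \+ series (fun k => a2 k * (t - t0) ^+ k).
  by apply/funext => m; rewrite /series /= -big_split /=; apply: eq_bigr => i _;
     rewrite mulrDl.
exact: cvgD.
Qed.

Lemma locally_pseriesZ h (c : R) : locally_pseries h ->
  locally_pseries (fun t => c * h t).
Proof.
move=> H t0; have [r [r0 [a A]]] := H t0; exists r; split => //.
exists (fun k => c * a k) => t /A cv.
have -> : series (fun k => c * a k * (t - t0) ^+ k) =
  (fun m => c * series (fun k => a k * (t - t0) ^+ k) m).
  by apply/funext => m; rewrite /series /= mulr_sumr; apply: eq_bigr => i _;
     rewrite mulrA.
by apply: cvgM => //; exact: cvg_cst.
Qed.

Lemma locally_pseries_affine (b c : R) : locally_pseries (fun t => b + c * t).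
Proof.
move=> t0; exists 1; split => //.
exists (fun k => if k is k'.+1 then (if k' is 0%N then c else 0) else b + c * t0) => t _.
apply: cvg_near_cst; exists 2%N => // -[|[|m]] //= _.
rewrite /series /= 2?big_nat_recl // big1 => [|i _]; last by rewrite mul0r.
by rewrite expr0 expr1; ring.
Qed.

Lemma locally_pseries_sum (I : Type) (s : seq I) (h : I -> R -> R) :
  (forall i, locally_pseries (h i)) -> locally_pseries (fun t => \sum_(i <- s) h i t).
Proof.
move=> H; elim: s => [|i s IH].
  have := locally_pseries_affine 0 0; congr locally_pseries.
  by apply/funext => t; rewrite big_nil mul0r addr0.
have := locally_pseriesD (H i) IH; congr locally_pseries.
by apply/funext => t; rewrite big_cons.
Qed.

Lemma locally_pseries_reflect h : locally_pseries h -> locally_pseries (fun t => h (1 - t)).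
Proof.
move=> H t0; have [r [r0 [a A]]] := H (1 - t0); exists r; split => //.
exists (fun k => a k * (-1) ^+ k) => t tr.
have := A (1 - t); have -> : 1 - t - (1 - t0) = - (t - t0) by ring.
rewrite normrN => /(_ tr).
have -> // : series (fun k => a k * (- (t - t0)) ^+ k) =
  series (fun k => a k * (-1) ^+ k * (t - t0) ^+ k).
by congr series; apply/funext => k; rewrite -mulrA -exprMn mulN1r.
Qed.

(** Let [S] be the supremum of the [s] such that [h] vanishes on [[0, s]]. Vanishing to the left of
    [S] kills the expansion at [S], so [h] vanishes beyond [S], a contradiction. *)
Lemma locally_pseries_zero_right h : locally_pseries h ->
  (forall t, 0 <= t <= 1 -> h t = 0) -> forall t, 0 <= t -> h t = 0.
Proof.
move=> H h01 T T0; apply/eqP/negP => /negP hT.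
pose Z := [set s : R | 0 <= s /\ forall t, 0 <= t <= s -> h t = 0].
have Z1 : Z 1 by split.
have ZT : ubound Z T.
  move=> s [s0 Zs]; rewrite leNgt; apply/negP => Ts.
  by rewrite Zs ?eqxx ?T0 ?ltW in hT.
have hs : has_sup Z by split; [exists 1 | exists T].
pose S := sup Z.
have S1 : 1 <= S by apply: ub_le_sup => //; case: hs.
have below t : 0 <= t -> t < S -> h t = 0.
  move=> t0 tS; have St0 : 0 < S - t by rewrite subr_gt0.
  have [e [_ Ze] te] := sup_adherent St0 hs.
  by apply: Ze; rewrite t0 ltW //; move: te; rewrite -/S; lra.
have [r [r0 [a A]]] := H S.
have az : forall k, a k = 0.
  (* The radius is cut down to [1] so that [S + s] stays nonnegative, as [1 <= S]. *)
  apply: (@pseries_eq0_left a (Num.min r 1)); first by rewrite lt_min r0 ltr01.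
  move=> s; rewrite ltrNl lt_min => /andP[sr s1] s0.
  have := A (S + s); rewrite [S + s - S]addrAC subrr add0r => /(_ _).
  rewrite below; [|lra|lra].
  by rewrite ltr0_norm // => /(_ sr).
have near t : `|t - S| < r -> h t = 0.
  move=> /A; have -> : series (fun k => a k * (t - S) ^+ k) = fun=> 0.
    by apply/funext => m; rewrite /series /= big1 // => i _; rewrite az mul0r.
  by move=> c; apply: (cvg_unique _ c (cvg_cst _)).
have : Z (S + r / 2).
  split; first by lra.
  move=> t /andP[t0 tS]; have [tS'|St] := ltP t S; first exact: below.
  by apply: near; rewrite ger0_norm; lra.
move=> /(ub_le_sup (proj2 hs)); rewrite -/S; lra.
Qed.

Lemma locally_pseries_zero h : locally_pseries h ->
  (forall t, 0 <= t <= 1 -> h t = 0) -> forall t, h t = 0.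
Proof.
move=> H h01 t; have [t0|t0] := leP 0 t; first exact: (locally_pseries_zero_right H).
have := locally_pseries_zero_right (locally_pseries_reflect H) _ (t := 1 - t).
rewrite subKr; apply; last by lra.
by move=> s /andP[s0 s1]; apply: h01; apply/andP; split; lra.
Qed.

End OneVariable.

(** * Restricting power series in several variables to lines *)

Section AnalyticAlongLines.
Variables (R : realType) (n : nat).
Notation X := 'rV[R]_n.

Lemma coord_le_norm (v : X) i : `|v 0 i| <= `|v|.
Proof.
rewrite [leRHS]/Num.Def.normr /= mx_normrE.
exact: (le_bigmax 0 (fun ij : 'I_1 * 'I_n => `|v ij.1 ij.2|) (0, i)).
Qed.

Lemma sum_multiindex_widen (G : ('I_n -> nat) -> R) k d : (k <= d)%N ->
  \sum_(alpha : {ffun 'I_n -> 'I_d.+1} | (\sum_i (alpha i : nat) == k)%N)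
     G (fun i => alpha i : nat) =
  \sum_(alpha : {ffun 'I_n -> 'I_k.+1} | (\sum_i (alpha i : nat) == k)%N)
     G (fun i => alpha i : nat).
Proof.
move=> kd; have kd1 : (k.+1 <= d.+1)%N by [].
rewrite (reindex_onto (fun b : {ffun 'I_n -> 'I_k.+1} => [ffun i => widen_ord kd1 (b i)])
  (fun a : {ffun 'I_n -> 'I_d.+1} => [ffun i => inord (a i) : 'I_k.+1])) /=.
  apply: eq_big => [b|b _].
    have -> : [ffun i => inord ([ffun i => widen_ord kd1 (b i)] i)] = b.
      by apply/ffunP => i; rewrite !ffunE /= inord_val.
    rewrite eqxx andbT; congr (_ == _); apply: eq_bigr => i _.
    by rewrite ffunE.
  by congr G; apply/funext => i; rewrite ffunE.
move=> a /eqP ak; apply/ffunP => i; apply: val_inj; rewrite !ffunE /= inordK //.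
by rewrite ltnS -ak (bigD1 i) //= leq_addr.
Qed.

(** The homogeneous part of degree [k] at [v], that is, the coefficient of [s ^+ k] on the line
    [a + s *: v]. *)
Definition line_coef (c : ('I_n -> nat) -> R) (v : X) k : R :=
  \sum_(alpha : {ffun 'I_n -> 'I_k.+1} | (\sum_i (alpha i : nat) == k)%N)
     c (fun i => alpha i : nat) * monomial (fun i => alpha i : nat) v.

(** Multi-indices are grouped by total degree; the degrees up to and including [d] give [d.+1] terms
    of the series. *)
Lemma psum_line c (a v : X) s d :
  psum c a (a + s *: v) d = series (fun k => line_coef c v k * s ^+ k) d.+1.
Proof.
rewrite /series /= big_mkord /psum.
rewrite (partition_big (fun alpha : {ffun 'I_n -> 'I_d.+1} =>
   inord (\sum_i (alpha i : nat)) : 'I_d.+1) predT) //=.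
apply: eq_bigr => k _; rewrite /line_coef.
have kd : (k <= d)%N by rewrite -ltnS.
rewrite -(sum_multiindex_widen (fun al => c al * monomial al v) kd) mulr_suml.
apply: eq_big => [al|al].
  apply/andP/eqP => [[le /eqP <-]|->]; first by rewrite inordK.
  by rewrite kd inord_val.
move=> /andP[le /eqP ak]; rewrite -mulrA; congr (_ * _).
have <- : (\sum_i (al i : nat) = k)%N by rewrite -ak inordK.
rewrite /monomial -prodrXr -big_split /=; apply: eq_bigr => i _.
by rewrite addrC addKr mxE mulrC exprMn.
Qed.

Lemma locally_pseries_line (g : X -> R) (x v : X) :
  (forall a, analytic_at g a) -> locally_pseries (fun t => g (x + t *: v)).
Proof.
move=> gA t0; have [r [r0 [c Hc]]] := gA (x + t0 *: v).
have V0 : 0 < 1 + `|v| by rewrite ltr_pwDl.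
exists (r / (1 + `|v|)); split; first by rewrite divr_gt0.
exists (line_coef c v) => t; rewrite ltr_pdivlMr // => tr.
have xE : x + t *: v = x + t0 *: v + (t - t0) *: v.
  by rewrite -addrA -scalerDl [t0 + _]addrC subrK.
have [|_ cv] := Hc (x + t *: v).
  move=> i; have -> : (x + t *: v) 0 i - (x + t0 *: v) 0 i = (t - t0) * v 0 i.
    by rewrite !mxE; ring.
  rewrite normrM; apply: le_lt_trans tr.
  rewrite ler_wpM2l //; apply: (@le_trans _ _ `|v|); last by rewrite lerDr.
  exact: coord_le_norm.
rewrite -(cvg_shiftn 1%N).
apply/cvgrPdist_lt => e e0; have [M HM] := cv e e0.
exists M => // d /= Md; rewrite distrC addn1 -(psum_line c (x + t0 *: v)) -xE; exact: HM.
Qed.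

End AnalyticAlongLines.

(** * Norms on row vectors *)

Section NormBasics.
Variables (R : realType) (n : nat).
Notation X := 'rV[R]_n.
Variable N : X -> R.
Hypothesis HN : is_norm N.

Lemma norm_eq0 x : N x = 0 -> x = 0. Proof. by case: HN => + _ _; apply. Qed.
Lemma normZ a x : N (a *: x) = `|a| * N x. Proof. by case: HN => _ + _; apply. Qed.
Lemma normD x y : N (x + y) <= N x + N y. Proof. by case: HN => _ _; apply. Qed.

Lemma norm0 : N 0 = 0. Proof. by rewrite -(scale0r 0) normZ normr0 mul0r. Qed.
Lemma normN x : N (- x) = N x. Proof. by rewrite -scaleN1r normZ normrN1 mul1r. Qed.
Lemma norm_distC x y : N (x - y) = N (y - x). Proof. by rewrite -normN opprB. Qed.

Lemma norm_ge0 x : 0 <= N x.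
Proof. by have := normD x (- x); rewrite subrr norm0 normN; lra. Qed.

Lemma norm_gt0 x : x <> 0 -> 0 < N x.
Proof. by move=> x0; rewrite lt0r norm_ge0 andbT; apply/eqP => /norm_eq0. Qed.

Lemma norm_dist y x z : N (x - z) <= N (x - y) + N (y - z).
Proof. by have := normD (x - y) (y - z); rewrite addrA subrK. Qed.

Lemma norm_distr x y : N x - N y <= N (x - y).
Proof. by have := normD (x - y) y; rewrite subrK; lra. Qed.

Lemma norm_sum (I : Type) (s : seq I) (F : I -> X) :
  N (\sum_(i <- s) F i) <= \sum_(i <- s) N (F i).
Proof.
elim: s => [|i s IH]; first by rewrite !big_nil norm0.
by rewrite !big_cons; apply: le_trans (normD _ _) _; rewrite lerD2l.
Qed.

Lemma norm_le_supnorm : exists2 C, 0 < C & forall x, N x <= C * `|x|.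
Proof.
pose C := \sum_(i < n) N (delta_mx 0 i).
have C0 : 0 <= C by apply: sumr_ge0 => i _; exact: norm_ge0.
exists (1 + C) => [|x]; first lra.
rewrite {1}(row_sum_delta x); apply: le_trans (norm_sum _ _) _.
apply: (@le_trans _ _ (C * `|x|)); last by rewrite ler_wpM2r //; lra.
rewrite mulr_suml; apply: ler_sum => i _.
by rewrite normZ mulrC ler_wpM2l ?norm_ge0 // coord_le_norm.
Qed.

Lemma lipschitz_continuous (h : X -> R) (C : R) :
  (forall x y, h x - h y <= C * `|x - y|) -> continuous h.
Proof.
move=> hC x; apply/(@cvgrPdist_lt _ _ _ (nbhs x) (nbhs_filter x)) => e e0.
have C1 : 0 < `|C| + 1 by rewrite ltr_wpDl.
apply/nbhs_ballP; exists (e / (`|C| + 1)) => [|y]; first by rewrite /= divr_gt0.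
rewrite -ball_normE /= ltr_pdivlMr // mulrC => xy.
have Cxy : C * `|x - y| < e.
  by apply: le_lt_trans xy; rewrite ler_wpM2r // (le_trans (ler_norm C)) // lerDl.
move: (hC x y) (hC y x); rewrite (distrC y x) ltr_norml; lra.
Qed.

Lemma is_norm_continuous : continuous N.
Proof.
have [C C0 NC] := norm_le_supnorm.
by apply: (@lipschitz_continuous N C) => x y; apply: le_trans (norm_distr _ _) (NC _).
Qed.

Lemma cvg_is_norm (U : set_system nat) (UU : Filter U) (u : nat -> X) (l : X) :
  u @ U --> l -> (fun k => N (u k)) @ U --> N l.
Proof. exact: (@continuous_cvg nat X R U _ u N l (@is_norm_continuous l)). Qed.

(** By compactness [N] has a positive minimum on the unit sphere of the sup norm. That sphere is
    empty in dimension zero, hence the case split. *)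
Lemma supnorm_le_norm : exists2 C, 0 < C & forall x, `|x| <= C * N x.
Proof.
have [[x0 hx0]|no] := pselect (exists x : X, `|x| = 1).
  pose S := [set x : X | `|x| = 1].
  have Sc : compact S.
    apply: bounded_closed_compact.
      by exists 1; split => // M M1 x /= ->; rewrite ltW.
    rewrite (_ : S = (fun x : X => `|x|) @^-1` [set 1]) //.
    apply: closed_comp; last exact: closed_eq.
    by move=> x _; apply: norm_continuous.
  have [||c cS cmin] := @EVT_min_rV R n N S _ Sc; first by exists x0.
    by apply: continuous_subspaceT; exact: is_norm_continuous.
  have Nc : 0 < N c.
    apply: norm_gt0 => c0; move: cS; rewrite inE /S /= c0 normr0 => /eqP.
    by rewrite eq_sym oner_eq0.
  exists (N c)^-1 => [|x]; first by rewrite invr_gt0.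
  have [->|x0'] := eqVneq x 0; first by rewrite normr0 norm0 mulr0.
  have xn : 0 < `|x| by rewrite normr_gt0.
  have : N c <= N (`|x|^-1 *: x).
    by apply: cmin; rewrite inE /S /= normrZ normfV normr_id mulVf // gt_eqF.
  rewrite normZ normfV normr_id ler_pdivlMl //.
  by rewrite ler_pdivlMl // [N c * _]mulrC.
exists 1 => [//|x]; rewrite mul1r.
have [->|x0'] := eqVneq x 0; first by rewrite normr0 norm0.
case: no; exists (`|x|^-1 *: x).
by rewrite normrZ normfV normr_id mulVf // normr_eq0.
Qed.

Lemma norm_ball_compact B : compact [set x : X | N x <= B].
Proof.
have [C C0 NC] := supnorm_le_norm.
apply: bounded_closed_compact.
  exists (C * B); split; first exact: num_real.
  move=> M M1 x /= xB; apply: le_trans (NC x) _; apply: le_trans (ltW M1).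
  by rewrite ler_wpM2l // ltW.
rewrite (_ : [set _ | _] = N @^-1` [set y | y <= B]) //.
apply: closed_comp; last exact: closed_le.
by move=> x _; exact: is_norm_continuous.
Qed.

Definition has_limits (U : set_system nat) :=
  forall (u : nat -> X) B, (forall k, N (u k) <= B) -> exists l : X, u @ U --> l.

(** An ultrafilter finer than [\oo] is mapped to an ultrafilter on a compact ball, which converges.
    One filter serves all bounded sequences at once. *)
Lemma exists_ultralimits :
  exists U : set_system nat, [/\ ProperFilter U, \oo `<=` U & has_limits U].
Proof.
have [U [UU oU]] := ultraFilterLemma (F := (\oo : set_system nat)) _.
exists U; split => //; first exact: ultra_proper.
move=> u B uB.
have UF : UltraFilter (u @ U).
  split; first exact: fmap_proper_filter.
  move=> G GP UG; rewrite eqEsubset; split => // A GA.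
  have [//|UA] := in_ultra_setVsetC (u @^-1` A) UU.
  have GA' : G (~` A) by apply: UG.
  by have /filter_ex [x []] : G (A `&` ~` A) by exact: filterI.
have := norm_ball_compact (B := B); rewrite compact_ultra => /(_ (u @ U) UF).
case.
  by apply: (@filterS _ U _ setT) => [k _|]; [exact: uB | exact: filterT].
by move=> l [_ ul]; exists l.
Qed.

End NormBasics.

(** * The averaged iteration *)

Section AveragedIteration.
Variables (R : realType) (n : nat).
Notation X := 'rV[R]_n.
Variables (N : X -> R) (f : X -> X).
Hypotheses (HN : is_norm N) (Hf : nonexpansive N f).
Local Notation g := (avg_map f).

Lemma avg_map_step x : g x - x = 2^-1 *: (f x - x).
Proof. by apply/rowP => i; rewrite !mxE; field. Qed.

Lemma avg_map_stepr x : f x - g x = 2^-1 *: (f x - x).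
Proof. by apply/rowP => i; rewrite !mxE; field. Qed.

Lemma norm_half x : N (2^-1 *: x) = N x / 2.
Proof. by rewrite (normZ HN) ger0_norm ?invr_ge0 // mulrC. Qed.

Lemma avg_map_nonexpansive : nonexpansive N g.
Proof.
move=> x y.
have -> : g x - g y = 2^-1 *: (f x - f y) + 2^-1 *: (x - y).
  by apply/rowP => i; rewrite !mxE; ring.
apply: le_trans (normD HN _ _) _; rewrite !norm_half.
have := Hf x y; lra.
Qed.

Lemma iter_avg_nonexpansive k : nonexpansive N (iter k g).
Proof.
move=> x y; elim: k => [//|k IH]; rewrite !iterS.
exact: le_trans (avg_map_nonexpansive _ _) IH.
Qed.

Lemma Fix_avg_map z : Fix f z -> g z = z.
Proof. by move=> zz; apply/eqP; rewrite -subr_eq0 avg_map_step zz subrr scaler0. Qed.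

Lemma Fix_iter_avg z k : Fix f z -> iter k g z = z.
Proof. by move=> zz; elim: k => //= k ->; exact: Fix_avg_map. Qed.

(** Passing through [f x], both parts of the way from [g x] to [f (g x)] are at most half of the old
    defect. *)
Lemma defect_nonincreasing x : N (f (g x) - g x) <= N (f x - x).
Proof.
apply: le_trans (norm_dist HN (f x) _ _) _.
rewrite avg_map_stepr norm_half.
have := Hf (g x) x; rewrite avg_map_step norm_half; lra.
Qed.

Lemma iter_defect_nonincreasing x k m : (k <= m)%N ->
  N (f (iter m g x) - iter m g x) <= N (f (iter k g x) - iter k g x).
Proof.
move=> /subnK <-; elim: (m - k)%N => [//|j IH].
by rewrite addSn iterS; apply: le_trans (defect_nonincreasing _) IH.
Qed.

(* The induction behind Ishikawa's theorem: if all defects lie in [d, d + e], the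
   orbit [u] drifts almost linearly. *)
Lemma ishikawa (u : nat -> X) (d e : R) : 0 <= e ->
  (forall i, u i.+1 = g (u i)) ->
  (forall i, d <= N (f (u i) - u i) <= d + e) ->
  forall k i, (1 + k%:R / 2) * d - 3 ^+ k * e <= N (f (u (i + k)%N) - u i).
Proof.
move=> e0 uS ud.
have travel m i : N (u (i + m)%N - u i) <= m%:R * ((d + e) / 2).
  elim: m => [|m IH]; first by rewrite addn0 subrr (norm0 HN) mul0r.
  apply: le_trans (norm_dist HN (u (i + m)%N) _ _) _.
  rewrite addnS uS avg_map_step norm_half -(natr1 m).
  have /andP[_] := ud (i + m)%N; lra.
elim=> [|k IH] i; first by rewrite addn0 expr0; have /andP[] := ud i; lra.
have := IH i.+1; rewrite addSnnS.
set v := u (i + k.+1)%N.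
(* This is the midpoint of [f v - f (u i)] and [f v - u i]; the first is bounded by the distance
   travelled, so the lower bound passes to the second. *)
have -> : f v - u i.+1 = 2^-1 *: (f v - f (u i)) + 2^-1 *: (f v - u i).
  by rewrite uS; apply/rowP => j; rewrite !mxE; field.
move=> /le_trans/(_ (normD HN _ _)); rewrite !norm_half.
have := Hf v (u i); have := travel k.+1 i.
rewrite -/v exprS -(natr1 k).
(* This lets [3 ^+ k.+1 * e] absorb the error in the travel bound. *)
have : k%:R + 1 <= 3 ^+ k :> R by rewrite natr1 -natrX ler_nat ltn_expl.
move=> /(ler_wpM2r e0).
have : 0 <= 3 ^+ k * e by rewrite mulr_ge0 // exprn_ge0.
lra.
Qed.

Variable x0 : X.
Hypothesis Hx0 : Fix f x0.

Lemma iter_avg_bounded x k : N (iter k g x - x0) <= N (x - x0).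
Proof. by rewrite -{1}(Fix_iter_avg k Hx0); exact: iter_avg_nonexpansive. Qed.

(** If the infimum [d] of the defects were positive, the drift in [ishikawa] would outgrow the
    bounded orbit. *)
Lemma asymptotic_regularity x e : 0 < e ->
  exists k, N (f (iter k g x) - iter k g x) < e.
Proof.
move=> e0; apply: contrapT => no.
pose D := [set N (f (iter k g x) - iter k g x) | k in [set: nat]].
have hD : has_inf D.
  split; first by exists (N (f (iter 0 g x) - iter 0 g x)), 0%N.
  by exists 0 => _ [k _ <-]; exact: norm_ge0.
pose d := inf D.
have dD k : d <= N (f (iter k g x) - iter k g x).
  by apply: ge_inf; [case: hD | exists k].
have d0 : 0 < d.
  apply: lt_le_trans e0 _; apply: lb_le_inf; first by case: hD.
  by move=> _ [k _ <-]; rewrite leNgt; apply/negP => ke; apply: no; exists k.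
pose B := N (x - x0).
(* With this [k], and with [eps] making the error term equal to [1], the drift exceeds [2 * B]. *)
have [k kB] : exists k : nat, 4 * (B + 1) / d < k%:R.
  by exists (Num.truncn (4 * (B + 1) / d)).+1; exact: truncnS_gt.
pose eps : R := (3 ^+ k)^-1.
have eps0 : 0 < eps by rewrite invr_gt0 exprn_gt0.
have [_ [M _ <-] HM] := inf_adherent eps0 hD.
have := @ishikawa (fun i => iter (i + M) g x) d eps (ltW eps0) _ _ k 0%N.
rewrite add0n mulfV ?expf_neq0 ?pnatr_eq0 // => /(_ (fun i => erefl)).
have ud i : d <= N (f (iter (i + M) g x) - iter (i + M) g x) <= d + eps.
  rewrite dD /=; apply: le_trans (ltW HM).
  exact/iter_defect_nonincreasing/leq_addl.
move=> /(_ ud).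
have := norm_dist HN x0 (f (iter (k + M) g x)) (iter (0 + M) g x).
have := Hf (iter (k + M) g x) x0; rewrite Hx0 (norm_distC HN x0).
have := iter_avg_bounded x (k + M); have := iter_avg_bounded x (0 + M).
rewrite -/B; move: kB; rewrite ltr_pdivrMr //.
have : 0 <= B by exact: norm_ge0.
lra.
Qed.

(** A cluster point of the bounded orbit is fixed since the defects tend to zero. Distances to a
    fixed point do not increase along the orbit, so the whole orbit converges to it. *)
Lemma limit_retraction_exists : exists Rf, is_limit_retraction N f Rf.
Proof.
suff H x : exists y, forall e, 0 < e ->
    exists M, forall k, (M <= k)%N -> N (iter k g x - y) < e.
  by have [Rf HR] := choice H; exists Rf.
have [U [UP oU UL]] := exists_ultralimits HN.
have [|y uy] := UL (fun k => iter k g x - x0) (N (x - x0)).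
  by move=> k; exact: iter_avg_bounded.
have cluster e m : 0 < e -> exists2 k, (m <= k)%N & N (iter k g x - (y + x0)) < e.
  move=> e0.
  have cv : (fun k => N (iter k g x - x0 - y)) @ U --> N (y - y).
    have cv1 : (fun k => iter k g x - x0 - y) @ U --> y - y by exact: cvgB (cvg_cst _).
    exact: cvg_is_norm cv1.
  rewrite subrr norm0 // in cv.
  have Ue : U [set k | N (iter k g x - x0 - y) < e].
    have := cvgr_lt _ cv e e0; exact.
  have Um : U [set k | (m <= k)%N] by apply: oU; exists m.
  have [k [/= ke km]] := filter_ex (filterI Ue Um).
  by exists k => //; rewrite opprD [- y - _]addrC addrA.
have yF : Fix f (y + x0).
  set z := y + x0.
  apply/eqP; rewrite -subr_eq0; apply/eqP/(norm_eq0 HN)/le_anti.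
  rewrite norm_ge0 // andbT; apply/ler_addgt0Pr => e e0; rewrite add0r.
  have e3 : 0 < e / 3 by rewrite divr_gt0.
  have [m Hm] := asymptotic_regularity x e3.
  have [k mk Hk] := cluster _ m e3.
  have := iter_defect_nonincreasing x mk.
  have := norm_dist HN (f (iter k g x)) (f z) z.
  have := norm_dist HN (iter k g x) (f (iter k g x)) z.
  have := Hf z (iter k g x); rewrite (norm_distC HN z).
  move: Hk; rewrite -/z; lra.
exists (y + x0) => e e0; have [m _ Hm] := cluster e 0%N e0.
exists m => k /subnK <-; apply: le_lt_trans Hm.
by rewrite iterD -{1}(Fix_iter_avg (k - m) yF); exact: iter_avg_nonexpansive.
Qed.

Variable Rf : X -> X.
Hypothesis HR : is_limit_retraction N f Rf.

Lemma retraction_le (phi : X -> R) c x : (forall y z, phi y - phi z <= N (y - z)) ->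
  (forall k, phi (iter k g x) <= c) -> phi (Rf x) <= c.
Proof.
move=> phiN phic; apply/ler_addgt0Pr => e e0; have [M HM] := HR x e0.
have := phiN (Rf x) (iter M g x); rewrite (norm_distC HN).
have := HM M (leqnn _); have := phic M; lra.
Qed.

Lemma retraction_nonexpansive x y : N (Rf x - Rf y) <= N (x - y).
Proof.
apply/ler_addgt0Pr => e e0.
have e2 : 0 < e / 2 by rewrite divr_gt0.
have [M1 H1] := HR x e2; have [M2 H2] := HR y e2.
have := H1 _ (leq_maxl M1 M2); have := H2 _ (leq_maxr M1 M2).
set k := maxn M1 M2.
have := norm_dist HN (iter k g x) (Rf x) (Rf y).
have := norm_dist HN (iter k g y) (iter k g x) (Rf y).
have := iter_avg_nonexpansive k x y.
rewrite (norm_distC HN (Rf x) (iter k g x)); lra.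
Qed.

(** Two consecutive iterates close to the limit are close to each other, and their distance is half
    a defect. *)
Lemma retraction_Fix x : Fix f (Rf x).
Proof.
apply/eqP; rewrite -subr_eq0; apply/eqP/(norm_eq0 HN).
apply/le_anti; rewrite norm_ge0 // andbT; apply/ler_addgt0Pr => e e0; rewrite add0r.
have e4 : 0 < e / 8 by rewrite divr_gt0.
have [M HM] := HR x e4; have := HM _ (leqnn M); have := HM _ (leqnSn M).
rewrite iterS; set u := iter M g x => h1 h2.
have := norm_dist HN (f u) (f (Rf x)) (Rf x).
have := norm_dist HN u (f u) (Rf x).
have := Hf (Rf x) u.
have := norm_dist HN (Rf x) (g u) u.
rewrite avg_map_step norm_half (norm_distC HN (Rf x) u); lra.
Qed.

End AveragedIteration.

(** * Polyhedral norms as maxima of functionals *)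

Section Functionals.
Variables (R : realType) (n : nat).

Definition dot (x : 'rV[R]_n) (a : 'cV[R]_n) : R := (x *m a) 0 0.

Lemma dotDl x y a : dot (x + y) a = dot x a + dot y a.
Proof. by rewrite /dot mulmxDl mxE. Qed.
Lemma dotNl x a : dot (- x) a = - dot x a.
Proof. by rewrite /dot mulNmx mxE. Qed.
Lemma dotBl x y a : dot (x - y) a = dot x a - dot y a.
Proof. by rewrite dotDl dotNl. Qed.
Lemma dotZl t x a : dot (t *: x) a = t * dot x a.
Proof. by rewrite /dot -scalemxAl mxE. Qed.
Lemma dotDr x a b : dot x (a + b) = dot x a + dot x b.
Proof. by rewrite /dot mulmxDr mxE. Qed.
Lemma dotNr x a : dot x (- a) = - dot x a.
Proof. by rewrite /dot mulmxN mxE. Qed.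
Lemma dotZr t x a : dot x (t *: a) = t * dot x a.
Proof. by rewrite /dot -scalemxAr mxE. Qed.
Lemma dot0l a : dot 0 a = 0.
Proof. by rewrite /dot mul0mx mxE. Qed.
Lemma dot0r x : dot x 0 = 0.
Proof. by rewrite /dot mulmx0 mxE. Qed.
Lemma dotE x a : dot x a = \sum_i x 0 i * a i 0.
Proof. by rewrite /dot mxE. Qed.
Lemma dot_delta x i : dot x (delta_mx i 0) = x 0 i.
Proof. by rewrite /dot -colE mxE. Qed.

Lemma dot_continuous a : continuous (fun x => dot x a).
Proof.
apply: (@lipschitz_continuous _ _ _ (\sum_i `|a i 0|)) => x y.
rewrite -dotBl dotE mulr_suml; apply: ler_sum => i _.
apply: le_trans (ler_norm _) _; rewrite normrM mulrC ler_wpM2l //.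
exact: coord_le_norm.
Qed.

End Functionals.

(** * Finitely generated cones as solution sets of finitely many inequalities *)

Section Weyl.
Variables (R : realType) (m : nat).

Lemma seq_max (x0 : R) (s : seq R) :
  exists2 y, y \in x0 :: s & forall z, z \in x0 :: s -> z <= y.
Proof.
elim: s x0 => [|x s IH] x0.
  by exists x0 => [|z]; rewrite mem_seq1 // => /eqP ->.
have [y ys ymax] := IH x; have [xy|yx] := leP x0 y.
  exists y => [|z]; first by rewrite in_cons ys orbT.
  by rewrite in_cons => /orP[/eqP -> //|]; exact: ymax.
exists x0 => [|z]; first exact: mem_head.
rewrite in_cons => /orP[/eqP -> //|/ymax zy]; exact: le_trans zy (ltW yx).
Qed.

Fixpoint in_cone (g : seq 'rV[R]_m) (x : 'rV[R]_m) : Prop :=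
  if g is b :: g' then exists2 l : R, 0 <= l & in_cone g' (x - l *: b) else x = 0.

Lemma in_cone0 g : in_cone g 0.
Proof. by elim: g => //= b g IH; exists 0 => //; rewrite scale0r subr0. Qed.

Lemma mem_in_cone g b : b \in g -> in_cone g b.
Proof.
elim: g => //= c g IH; rewrite in_cons => /orP[/eqP ->|bg].
  by exists 1 => //; rewrite scale1r subrr; exact: in_cone0.
by exists 0 => //; rewrite scale0r subr0; exact: IH.
Qed.

(* By Fourier-Motzkin elimination of the coefficient of one generator at a time. *)
Lemma weyl g : exists s : seq 'cV[R]_m,
  forall x, in_cone g x <-> (forall a, a \in s -> dot x a <= 0).
Proof.
elim: g => [|b g [s IH]].
  pose d := [seq delta_mx i 0 | i <- enum 'I_m] : seq 'cV[R]_m.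
  exists (d ++ [seq - a | a <- d]) => x /=; split => [-> a _|H].
    by rewrite dot0l.
  apply/rowP => i; rewrite mxE; apply/le_anti.
  have id : delta_mx i 0 \in d by apply: map_f; rewrite mem_enum.
  rewrite -(dot_delta x i) H ?mem_cat ?id //= -oppr_le0 -dotNr H //.
  by rewrite mem_cat map_f ?orbT.
pose P := [seq a <- s | 0 < dot b a].
pose M := [seq a <- s | dot b a < 0].
(* A constraint that [b] respects is kept; a violated one [p] is combined with a [q] that is
   negative at [b], so that the result vanishes at [b]. *)
exists ([seq a <- s | dot b a <= 0] ++
   [seq dot b p *: q - dot b q *: p | p <- P, q <- M]) => x /=; split.
  move=> [l l0 /IH H] a; rewrite mem_cat => /orP[|].
    rewrite mem_filter => /andP[ba as_]; have := H a as_.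
    by rewrite dotBl dotZl; nra.
  move=> /allpairsP[[p q] /= []]; rewrite !mem_filter => /andP[p0 ps] /andP[q0 qs] ->.
  have := H p ps; have := H q qs; rewrite !dotBl !dotZl dotDr dotNr !dotZr; nra.
move=> H.
(* The constraints in [P] bound the multiplier of [b] from below; the largest of these bounds and
   [0] is taken. *)
have [l ls lmax] := seq_max 0 [seq dot x p / dot b p | p <- P].
have l0 : 0 <= l by apply: lmax; exact: mem_head.
exists l => //; apply/IH => a as_; rewrite dotBl dotZl subr_le0.
have Ha : dot b a <= 0 -> dot x a <= 0.
  by move=> ba; apply: H; rewrite mem_cat mem_filter ba as_.
have [ba|ba|ba] := ltgtP (dot b a) 0; last by rewrite ba mulr0 Ha // ba.
- move: ls; rewrite in_cons => /orP[/eqP ->|/mapP[p pP ->]].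
    by rewrite mul0r Ha // ltW.
  move: (pP); rewrite mem_filter => /andP[p0 ps].
  rewrite mulrAC ler_pdivlMr //.
  have : dot x (dot b p *: a - dot b a *: p) <= 0.
    apply: H; rewrite mem_cat; apply/orP; right.
    by apply/allpairsP; exists (p, a); split => //; rewrite mem_filter ba.
  by rewrite dotDr dotNr !dotZr; lra.
- rewrite -ler_pdivrMr //; apply: lmax; rewrite in_cons; apply/orP; right.
  by apply/mapP; exists a => //; rewrite mem_filter ba.
Qed.

End Weyl.

(** * Extreme points of the ball and norming functionals *)

Section Minkowski.
Variables (R : realType) (n : nat).
Notation X := 'rV[R]_n.
Variable N : X -> R.
Hypothesis HN : is_norm N.

(** The nonempty compact extreme subsets of the ball; if such a set is a single point, this is an
    extreme point. *)
Definition ball_face (F : set X) := [/\ F !=set0, compact F,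
  F `<=` unit_ball N & forall (y z : X) (t : R), unit_ball N y -> unit_ball N z ->
    0 < t < 1 -> F (t *: y + (1 - t) *: z) -> F y /\ F z].

(** A functional that is maximal at an inner point of a segment is constant on the segment. *)
Lemma ball_face_argmax F a : ball_face F ->
  ball_face [set x | F x /\ forall y, F y -> dot y a <= dot x a].
Proof.
move=> [F0 Fc FB Fext].
have [|c cF cmax] := EVT_max_rV F0 Fc (f := fun x => dot x a).
  by apply: continuous_subspaceT; exact: dot_continuous.
rewrite inE in cF.
have {}cmax y : F y -> dot y a <= dot c a by move=> Fy; apply: cmax; rewrite inE.
split; first by exists c.
- have -> : [set x | F x /\ (forall y, F y -> dot y a <= dot x a)] =
      F `&` (fun x => dot x a) @^-1` [set r | dot c a <= r].
    apply/seteqP; split => x /= [Fx xmax]; split => //; first exact: xmax.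
    by move=> y Fy; exact: le_trans (cmax y Fy) xmax.
  rewrite setIC; apply: (subclosed_compact _ Fc); last by move=> x [].
  apply: closedI; last exact: compact_closed.
  by apply: closed_comp => [x _|]; [exact: dot_continuous | exact: closed_ge].
- by move=> x [/FB].
move=> y z t By Bz t01 [Fyz max]; have [Fy Fz] := Fext _ _ _ By Bz t01 Fyz.
have := max y Fy; have := max z Fz; rewrite dotDl !dotZl => h1 h2.
have [t0 t1] := andP t01.
have yz : dot y a = dot z a by apply/le_anti/andP; split; nra.
by split; split => // w /max; rewrite dotDl !dotZl yz; lra.
Qed.

(* Maximizing the coordinates one after the other shrinks a face to a point. *)
Lemma extreme_point_argmax a :
  exists2 b, extreme_point N b & forall y, unit_ball N y -> dot y a <= dot b a.
Proof.
have B0 : ball_face (unit_ball N).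
  split => //; last exact: norm_ball_compact.
  by exists 0; rewrite /unit_ball (norm0 HN).
have := ball_face_argmax a B0; set F1 := [set x | _] => F1face.
have [F [[[b Fb] Fc FB Fext] FF1 Feq]] : exists F, [/\ ball_face F, F `<=` F1 &
    forall i, i \in enum 'I_n -> forall x y, F x -> F y -> x 0 i = y 0 i].
  elim: (enum 'I_n) => [|j s [F [Fface FF1 Feq]]]; first by exists F1; split.
  exists [set x | F x /\ forall y, F y -> dot y (delta_mx j 0) <= dot x (delta_mx j 0)].
  split; [exact: ball_face_argmax | by move=> x [/FF1] |].
  move=> i; rewrite in_cons => /orP[/eqP ->|js] x y [Fx xmax] [Fy ymax].
    by rewrite -!dot_delta; apply/le_anti; rewrite xmax ?ymax.
  exact: Feq.
have single x : F x -> x = b.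
  by move=> Fx; apply/rowP => i; apply: Feq; rewrite ?mem_enum.
exists b; last by have [] := FF1 _ Fb.
split; first exact: FB.
move=> y z t By Bz t01 byz; have [] := Fext y z t By Bz t01; first by rewrite -byz.
by move=> /single -> /single ->.
Qed.

(** The generators [(b, 1)] lie in the epigraph of [N], which is a convex cone. *)
Lemma in_cone_norm (E : seq X) y : (forall b, b \in E -> N b <= 1) ->
  in_cone [seq row_mx b (1%:M : 'M_1) | b <- E] y ->
  N (lsubmx y) <= (rsubmx y : 'M_1) 0 0.
Proof.
elim: E y => [y _ /= ->|b E IH y EB /= [l l0 H]].
  by rewrite !linear0 (norm0 HN) mxE.
have := IH _ _ H; rewrite !linearB !linearZ /= row_mxKl row_mxKr scalerN => h.
have {}h : N (lsubmx y - l *: b) <= rsubmx y 0 0 - l.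
  rewrite (_ : _ - l = (rsubmx y + l *: - 1%:M) 0 0).
    by apply: h => c cE; apply: EB; rewrite in_cons cE orbT.
  rewrite [RHS]mxE; congr (_ + _).
  by rewrite scalerN mxE [in RHS]mxE [X in _ * X]mxE eqxx mulr1.
have := normD HN (lsubmx y - l *: b) (l *: b); rewrite subrK (normZ HN) ger0_norm //.
have := EB b (mem_head _ _); nra.
Qed.

(** The cone over the extreme points, placed at height [1], is cut out by finitely many
    inequalities. Each holds on the whole ball, because a functional is maximal at an extreme point;
    dividing by the constant terms gives the functionals. *)
Lemma polyhedral_functionals : polyhedral_norm N ->
  exists (m : nat) (phi : 'I_m -> 'cV[R]_n),
    (forall i x, dot x (phi i) <= N x) /\ (forall x, exists i, dot x (phi i) = N x).
Proof.
move=> [_ [s0 Hs0]].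
pose E := [seq b <- s0 | `[< extreme_point N b >]].
have EP b : b \in E -> extreme_point N b by rewrite mem_filter => /andP[/asboolP].
have [S HS] := weyl [seq row_mx b (1%:M : 'M_1) | b <- E].
(* With this sign the constraint [a] on [(x, t)] reads [dot x (usubmx a) <= t * al a]. *)
pose al (a : 'cV[R]_(n + 1)) := - (dsubmx a : 'M_1) 0 0.
have dotS x t a : dot (row_mx x (t%:M : 'M_1)) a = dot x (usubmx a) - t * al a.
  by rewrite -{1}(vsubmxK a) /dot mul_row_col mul_scalar_mx mxE [X in _ + X]mxE /al mulrN opprK.
have ball_bound a : a \in S -> forall y, N y <= 1 -> dot y (usubmx a) <= al a.
  move=> aS y y1; have [b bext bmax] := extreme_point_argmax (usubmx a).
  apply: le_trans (bmax y y1) _.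
  have bE : b \in E by rewrite mem_filter Hs0 // andbT; apply/asboolP.
  have := proj1 (HS _) (mem_in_cone (map_f _ bE)) a aS.
  by rewrite dotS mul1r subr_le0.
have al0 a : a \in S -> 0 <= al a.
  by move=> aS; have := ball_bound a aS 0; rewrite (norm0 HN) dot0l; apply.
have Nbound a x : a \in S -> dot x (usubmx a) <= N x * al a.
  move=> aS; have [->|x0] := eqVneq x 0; first by rewrite dot0l (norm0 HN) mul0r.
  have Nx : 0 < N x by apply: norm_gt0 => //; exact/eqP.
  have := ball_bound a aS ((N x)^-1 *: x).
  rewrite (normZ HN) normfV (gtr0_norm Nx) mulVf ?gt_eqF // lexx dotZl.
  by move=> /(_ isT); rewrite ler_pdivrMl.
(* A constraint with [al a = 0] only says that a functional is nonpositive everywhere; the extra [0]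
   makes the maximum nonnegative. *)
pose L := 0 :: [seq (al a)^-1 *: usubmx a | a <- S & 0 < al a].
have LN a x : a \in L -> dot x a <= N x.
  rewrite in_cons => /orP[/eqP ->|/mapP[c]]; first by rewrite dot0r norm_ge0.
  rewrite mem_filter => /andP[c0 cS] ->.
  by rewrite dotZr ler_pdivrMl // mulrC Nbound.
have LE x : exists2 a, a \in L & dot x a = N x.
  have [t tL tmax] := seq_max (dot x 0) [seq dot x a | a <- behead L].
  have /mapP[a aL ta] : t \in [seq dot x a | a <- L] by [].
  exists a => //; apply/le_anti; rewrite LN //= -ta.
  have t0 : 0 <= t by rewrite -(dot0r x) tmax ?mem_head.
  (* At height [t], the maximum of the functionals at [x], every constraint holds, so membership in
     the cone yields [N x <= t]. *)
  have : in_cone [seq row_mx b (1%:M : 'M_1) | b <- E] (row_mx x (t%:M : 'M_1)).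
    apply/HS => c cS; rewrite dotS subr_le0.
    have := al0 c cS; rewrite le_eqVlt => /orP[/eqP c0|c0].
      by have := Nbound c x cS; rewrite -c0 !mulr0.
    rewrite -ler_pdivrMr // mulrC -dotZr; apply: tmax; rewrite in_cons.
    apply/orP; right; apply: map_f; apply: map_f.
    by rewrite mem_filter c0.
  move=> /in_cone_norm; rewrite row_mxKl row_mxKr mxE eqxx; apply.
  by move=> b /EP[].
exists (size L), (fun i => tnth (in_tuple L) i); split => [i x|x].
  by apply: LN; exact: mem_tnth.
have [a aL ax] := LE x.
have /tnthP[i ai] : a \in in_tuple L by [].
by exists i; rewrite -ai.
Qed.

End Minkowski.

(** * Linearization of nonexpansive liftings *)

Section Linearization.
Variables (R : realType) (n : nat).
Notation X := 'rV[R]_n.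
Variable N : X -> R.
Hypothesis HN : is_norm N.

Lemma arch_bound_le (a b c : R) : (forall k : nat, k%:R * a <= k%:R * b + c) -> a <= b.
Proof.
move=> H; rewrite leNgt; apply/negP => ba.
have ab : 0 < a - b by rewrite subr_gt0.
have := H (Num.truncn (c / (a - b))).+1.
have := truncnS_gt (c / (a - b)); rewrite ltr_pdivrMr //; lra.
Qed.

Section Ultralimits.
Variable U : set_system nat.
Hypotheses (UP : ProperFilter U) (oU : \oo `<=` U).

Lemma norm_ulim_le (u : nat -> X) (l z : X) (c d : R) : u @ U --> l ->
  (forall k, k.+1%:R * N (u k - z) <= k.+1%:R * d + c) -> N (l - z) <= d.
Proof.
move=> ul H; apply/ler_addgt0Pr => e e0.
have cv : (fun k => N (u k - z)) @ U --> N (l - z).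
  by apply: (cvg_is_norm HN); apply: cvgB => //; exact: cvg_cst.
rewrite -(cvg_lim _ cv) //; apply: limr_le; first exact: cvgP cv.
apply: oU; exists (Num.truncn (c / e)) => // k /= ck.
have : c / e < k.+1%:R.
  by apply: lt_le_trans (truncnS_gt _) _; rewrite ler_nat ltnS.
rewrite ltr_pdivrMr // => ck1.
have k0 : 0 < k.+1%:R :> R by rewrite ltr0n.
rewrite -(ler_pM2l k0); have := H k; lra.
Qed.

Lemma dot_ulim (u : nat -> X) (l : X) a (c : R) : u @ U --> l ->
  (forall k, dot (u k) a = c) -> dot l a = c.
Proof.
move=> ul H.
have cv : (fun k => dot (u k) a) @ U --> dot l a.
  exact: (@continuous_cvg nat X R U _ u (fun x => dot x a) l (@dot_continuous _ _ a l) ul).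
have cvc : (fun k => dot (u k) a) @ U --> c.
  by rewrite (_ : (fun k => _) = fun=> c); [exact: cvg_cst | exact/funext].
by rewrite -(cvg_lim _ cv) // (cvg_lim _ cvc).
Qed.

End Ultralimits.

Variables (k : nat) (P : 'M[R]_(k, n)) (A : 'cV[R]_n -> Prop) (Q : 'rV[R]_k -> R).
Hypotheses (Q0 : forall u, 0 <= Q u)
  (QZ : forall t u, 0 <= t -> Q (t *: u) = t * Q u)
  (QD : forall u v, Q (u + v) <= Q u + Q v).

(** Both conditions concern increments only, so they survive translation, averaging and limits. *)
Definition lifting (s : 'rV[R]_k -> X) :=
  (forall u v, N (s u - s v) <= Q (u - v)) /\
  (forall a, A a -> forall u v, dot (s u - s v) a = dot ((u - v) *m P) a).

(* [s'] is an ultralimit of Cesaro means of the translates of [s] along [e]; the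
   sums telescope on increments along [e]. *)
Lemma lifting_periodic s e : lifting s -> exists s', [/\ lifting s',
  exists t, forall u, s' (u + e) - s' u = t &
  forall e' t, (forall u, s (u + e') - s u = t) -> forall u, s' (u + e') - s' u = t].
Proof.
move=> [sQ sA].
have [U [UP oU UL]] := exists_ultralimits HN.
pose d u j := s (u + j%:R *: e) - s (j%:R *: e).
pose av u m : X := m.+1%:R^-1 *: \sum_(0 <= j < m.+1) d u j.
have nat0 m : m.+1%:R != 0 :> R by rewrite pnatr_eq0.
have mean_le (F : nat -> X) (c : R) m : (forall j, N (F j) <= c) ->
    N (m.+1%:R^-1 *: \sum_(0 <= j < m.+1) F j) <= c.
  move=> Fc; rewrite (normZ HN) ger0_norm ?invr_ge0 // ler_pdivrMl ?ltr0n //.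
  apply: le_trans (norm_sum HN _ _) _.
  apply: le_trans (ler_sum _ (fun j _ => Fc j)) _.
  by rewrite big_const_nat iter_addr_0 subn0 mulr_natl.
have avB u v m : av u m - av v m =
    m.+1%:R^-1 *: \sum_(0 <= j < m.+1) (s (u + j%:R *: e) - s (v + j%:R *: e)).
  rewrite /av -scalerBr -sumrB; congr (_ *: _); apply: eq_bigr => j _.
  by rewrite /d opprB addrA subrK.
have av_cvg u : exists l : X, av u @ U --> l.
  apply: (UL _ (Q u)) => m; apply: mean_le => j.
  by apply: le_trans (sQ _ _) _; rewrite addrK.
have [s' s'P] := choice av_cvg.
have avB_cvg u v : (fun m => av u m - av v m) @ U --> s' u - s' v by exact: cvgB.
exists s'; split; [split | |].
- move=> u v; have := norm_ulim_le UP oU (z := 0) (c := 0) (avB_cvg u v) (d := Q (u - v)).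
  rewrite subr0; apply => m; rewrite subr0 addr0 ler_wpM2l // avB.
  apply: mean_le => j; apply: le_trans (sQ _ _) _.
  by rewrite opprD addrACA subrr addr0.
- move=> a Aa u v; apply: (dot_ulim UP (avB_cvg u v)) => m.
  rewrite avB dotZl /dot mulmx_suml summxE.
  rewrite (eq_bigr (fun=> dot ((u - v) *m P) a)); last first.
    move=> j _; rewrite -/(dot _ a) sA //; congr (dot (_ *m P) a).
    by rewrite opprD addrACA subrr addr0.
  by rewrite big_const_nat iter_addr_0 subn0 -[dot _ _ *+ _]mulr_natl mulKf.
(* The increments of the means telescope, so those at [u] and at [0] differ by at most
   [2 * Q u / m.+1]; the limit increment is independent of [u]. *)
- exists (s' e - s' 0) => u; apply/eqP; rewrite -subr_eq0; apply/eqP/(norm_eq0 HN).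
  apply/le_anti; rewrite norm_ge0 // andbT.
  have cv : (fun m => av (u + e) m - av u m - (av e m - av 0 m)) @ U -->
      s' (u + e) - s' u - (s' e - s' 0) by apply: cvgB; exact: avB_cvg.
  rewrite -[X in N X]subr0; apply: (norm_ulim_le UP oU (c := 2 * Q u) cv) => m.
  have tele w : av (w + e) m - av w m = m.+1%:R^-1 *: (s (w + m.+1%:R *: e) - s w).
    rewrite avB (eq_bigr (fun j => s (w + j.+1%:R *: e) - s (w + j%:R *: e))).
      by rewrite telescope_sumr // scale0r addr0.
    by move=> j _; rewrite -addrA -{1}(scale1r e) -scalerDl nat1r.
  rewrite subr0 mulr0 add0r -{2}(add0r e) !tele -scalerBr (normZ HN).
  rewrite ger0_norm ?invr_ge0 // mulVKf //.
  set w := m.+1%:R *: e.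
  have -> : s (u + w) - s u - (s (0 + w) - s 0) = (s (u + w) - s w) - (s u - s 0).
    by rewrite add0r; apply/rowP => j; rewrite !mxE; ring.
  apply: le_trans (normD HN _ _) _; rewrite normN //.
  have := sQ (u + w) w; have := sQ u 0; rewrite addrK subr0; lra.
(* A constant increment along another [e'] is unchanged by averaging, so directions can be treated
   one after the other. *)
- move=> e' t st u; apply/eqP; rewrite -subr_eq0; apply/eqP/(norm_eq0 HN).
  apply/le_anti; rewrite norm_ge0 // andbT.
  apply: (norm_ulim_le UP oU (c := 0) (avB_cvg (u + e') u)) => m.
  rewrite avB (eq_bigr (fun=> t)); last by move=> j _; rewrite addrAC st.
  rewrite big_const_nat iter_addr_0 subn0 -[t *+ _]scaler_nat scalerA mulVf // scale1r.
  by rewrite subrr norm0 // mulr0 addr0.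
Qed.

(** Once all basis directions have been treated, [s'] is affine on the integer lattice; rescaling
    carries the bound by [Q] to all vectors. *)
Lemma lifting_linear s : lifting s -> exists T : 'M[R]_(k, n),
  (forall u, N (u *m T) <= Q u) /\ (forall a, A a -> T *m a = P *m a).
Proof.
move=> sL.
have [s' [[s'Q s'A] s'per]] : exists s', lifting s' /\
    forall i, i \in enum 'I_k -> exists t, forall u, s' (u + delta_mx 0 i) - s' u = t.
  elim: (enum 'I_k) => [|i r [s1 [s1L s1per]]]; first by exists s; split.
  have [s2 [s2L s2i s2per]] := lifting_periodic (delta_mx 0 i) s1L.
  exists s2; split => // j; rewrite in_cons => /orP[/eqP -> //|/s1per [t Ht]].
  by exists t; exact: s2per.
have {}s'per i : exists t, forall u, s' (u + delta_mx 0 i) - s' u = t.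
  by apply: s'per; rewrite mem_enum.
have [t Ht] := choice s'per.
pose T := \matrix_i t i.
have rowT i : row i T = t i by rewrite rowK.
have step i (j : nat) u : s' (u + j%:R *: delta_mx 0 i) = s' u + j%:R *: t i.
  elim: j => [|j IH]; first by rewrite !scale0r !addr0.
  rewrite -natr1 !scalerDl !scale1r !addrA -IH.
  by rewrite -(Ht i (u + j%:R *: delta_mx 0 i)) [RHS]addrC subrK.
have stepz i (z : int) u : s' (u + z%:~R *: delta_mx 0 i) = s' u + z%:~R *: t i.
  case: z => j; first exact: step.
  rewrite NegzE mulrNz !scaleNr; apply/eqP; rewrite eq_sym subr_eq; apply/eqP.
  by rewrite -(step i j.+1) subrK.
have stepv (z : 'I_k -> int) : s' (\row_i (z i)%:~R) - s' 0 = (\row_i (z i)%:~R) *m T.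
  have H (r : seq 'I_k) : s' (\sum_(i <- r) (z i)%:~R *: delta_mx 0 i) =
      s' 0 + \sum_(i <- r) (z i)%:~R *: t i.
    elim: r => [|i r IH]; first by rewrite !big_nil addr0.
    by rewrite !big_cons [X in s' X]addrC stepz IH -addrA; congr (_ + _); rewrite addrC.
  rewrite mulmx_sum_row [X in s' X]row_sum_delta.
  under eq_bigr do rewrite mxE.
  rewrite H addrC addKr; apply: eq_bigr => i _.
  by rewrite mxE rowT.
have zQ (z : 'I_k -> int) : N ((\row_i (z i)%:~R) *m T) <= Q (\row_i (z i)%:~R).
  by rewrite -stepv; apply: le_trans (s'Q _ _) _; rewrite subr0.
exists T; split; last first.
  move=> a Aa; apply/colP => i.
  have dotrow (M : 'M[R]_(k, n)) : (M *m a) i 0 = dot (row i M) a.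
    by rewrite /dot -row_mul [RHS]mxE.
  rewrite !dotrow (rowE i P).
  by rewrite rowT -(Ht i 0) add0r s'A // subr0.
(* The vector [m%:R *: v] is an integer vector plus a remainder [r] in the unit cube; [C1] and [C2]
   bound the cost of [r] independently of [m]. *)
move=> v; pose C1 := \sum_i N (t i); pose C2 := \sum_i Q (- delta_mx 0 i).
apply: (@arch_bound_le _ _ (C1 + C2)) => m.
pose z i := Num.floor (m%:R * v 0 i).
pose r : 'rV[R]_k := \row_i (m%:R * v 0 i - (z i)%:~R).
have r01 i : 0 <= r 0 i <= 1.
  rewrite mxE; have := floor_itv (m%:R * v 0 i); rewrite intrD -/(z i); lra.
have mv : m%:R *: v = \row_i (z i)%:~R + r.
  by apply/rowP => i; rewrite !mxE; ring.
have rT : N (r *m T) <= C1.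
  rewrite mulmx_sum_row; apply: le_trans (norm_sum HN _ _) _.
  apply: ler_sum => i _; rewrite rowT (normZ HN).
  have /andP[r0 r1] := r01 i.
  by rewrite ger0_norm // ler_piMl // norm_ge0.
have Qr : Q (- r) <= C2.
  have -> : - r = \sum_i r 0 i *: - delta_mx 0 i.
    rewrite {1}[r]row_sum_delta -sumrN; apply: eq_bigr => i _.
    by rewrite scalerN.
  rewrite /C2; elim: (index_enum _) => [|i l IH].
    rewrite !big_nil -(scale0r (0 : 'rV[R]_k)) QZ // mul0r //.
  rewrite !big_cons; apply: le_trans (QD _ _) _; apply: lerD => //.
  have /andP[r0 r1] := r01 i.
  by rewrite QZ // ler_piMl.
have -> : m%:R * N (v *m T) = N ((\row_i (z i)%:~R) *m T + r *m T).
  by rewrite -mulmxDl -mv -scalemxAl (normZ HN) ger0_norm.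
have zE : \row_i (z i)%:~R = m%:R *: v + - r by rewrite mv addrK.
apply: le_trans (normD HN _ _) _.
have := zQ z; have := QD (m%:R *: v) (- r); rewrite -zE QZ //; lra.
Qed.

End Linearization.

(** * Norming sets and rigid lines *)

Section Faces.
Variables (R : realType) (n : nat).
Notation X := 'rV[R]_n.
Variables (N : X -> R) (f : X -> X).
Hypotheses (HN : is_norm N) (Hf : nonexpansive N f) (Af : real_analytic f).
Variables (m : nat) (phi : 'I_m -> 'cV[R]_n).
Hypotheses (phi_le : forall i x, dot x (phi i) <= N x)
  (phi_attained : forall x, exists i, dot x (phi i) = N x).

Definition norming (v : X) : {set 'I_m} := [set i | dot v (phi i) == N v].

Lemma normingP v i : reflect (dot v (phi i) = N v) (i \in norming v).
Proof. by rewrite inE; exact: eqP. Qed.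

(** An index that does not norm [v] stays below [N v] by a positive gap, which for large [t]
    outweighs the influence of [w]. *)
Lemma norming_perturb v w :
  exists t0, forall t, t0 <= t -> 0 <= t /\ norming (t *: v + w) \subset norming v.
Proof.
pose gap i := N v - dot v (phi i).
have gap0 i : 0 <= gap i by rewrite subr_ge0.
(* For [i] norming [v] the gap is [0] and so is [b i], as division by zero returns [0]. *)
pose b i := (2 * N w + 1) / gap i.
have w0 : 0 < 2 * N w + 1 by have := norm_ge0 HN w; lra.
have b0 i : 0 <= b i by rewrite divr_ge0 // ltW.
exists (\sum_i b i) => t tb; split; first by apply: le_trans tb; exact: sumr_ge0.
apply/fintype.subsetP => i /normingP; apply: contraPT => iv Hi.
have gi : 0 < gap i.
  rewrite lt0r gap0 andbT subr_eq0; apply: contra iv => /eqP e.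
  by apply/normingP.
have : b i <= t by apply: le_trans tb; rewrite (bigD1 i) //= lerDl sumr_ge0.
rewrite ler_pdivrMr // /gap => tg.
have t0 : 0 <= t by apply: le_trans tb; exact: sumr_ge0.
have := normD HN (t *: v + w) (- w); rewrite addrK (normZ HN) ger0_norm // (normN HN).
rewrite -Hi dotDl dotZl; have := phi_le i w; lra.
Qed.

Definition rigid_along (x v : X) := forall i, i \in norming v ->
  forall t, dot (f (x + t *: v)) (phi i) = dot (x + t *: v) (phi i).

(** On [[0, 1]] the bounds [t * N v] and [(1 - t) * N v] add up to [N v], so both are equalities;
    analyticity extends this to all [t]. The assumptions concern norming values only, so that a
    point of a rigid line can serve as an endpoint. *)
Lemma rigid_along_pair x y :
  (forall i, i \in norming (y - x) -> dot (f x) (phi i) = dot x (phi i)) ->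
  (forall i, i \in norming (y - x) -> dot (f y) (phi i) = dot y (phi i)) ->
  rigid_along x (y - x).
Proof.
move=> fx fy i iF; set v := y - x.
pose h t := dot (f (x + t *: v)) (phi i) - dot (x + t *: v) (phi i).
suff h0 t : h t = 0 by move=> t; apply/eqP; rewrite -subr_eq0; apply/eqP/h0.
apply: locally_pseries_zero => [|{}t /andP[t0 t1]].
  have H : locally_pseries (fun t => \sum_(j <- index_enum 'I_n) phi i j 0 * f (x + t *: v) 0 j).
    apply: locally_pseries_sum => j; apply: locally_pseriesZ.
    exact: (locally_pseries_line x v (Af j)).
  have := locally_pseriesD H (locally_pseries_affine (- dot x (phi i)) (- dot v (phi i))).
  congr locally_pseries; apply/funext => s; rewrite /h (dotDl x) (dotZl s) opprD mulNr.
  congr (_ + _); last by rewrite mulrC.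
  by rewrite dotE; apply: eq_bigr => j _; rewrite mulrC.
have Nv : dot v (phi i) = N v by apply/normingP.
have h1 : dot (f (x + t *: v)) (phi i) - dot x (phi i) <= t * N v.
  rewrite -(fx i iF) -dotBl; apply: le_trans (phi_le _ _) _; apply: le_trans (Hf _ _) _.
  by rewrite addrAC subrr add0r (normZ HN) ger0_norm.
have h2 : dot y (phi i) - dot (f (x + t *: v)) (phi i) <= (1 - t) * N v.
  rewrite -(fy i iF) -dotBl; apply: le_trans (phi_le _ _) _; apply: le_trans (Hf _ _) _.
  rewrite (_ : y - _ = (1 - t) *: v); first by rewrite (normZ HN) ger0_norm ?subr_ge0.
  by rewrite opprD addrA -/v scalerBl scale1r.
have h3 : dot y (phi i) = dot x (phi i) + N v by rewrite -Nv dotBl; ring.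
by apply/le_anti; rewrite /h dotDl dotZl Nv; apply/andP; split; lra.
Qed.

(** Points of the line far out in the direction [- v] bound [dot (f p - x) (phi i)] from above by
    [c], those in the direction [v] from below. For such points only indices norming [v] attain the
    norm. *)
Lemma rigid_along_level x v p c : rigid_along x v ->
  (forall i, i \in norming v -> dot (p - x) (phi i) = c) ->
  forall i, i \in norming v -> dot (f p - x) (phi i) = c.
Proof.
move=> rig pc i iF; have Nv : dot v (phi i) = N v by apply/normingP.
have far w d : (forall j, j \in norming v -> dot w (phi j) = d) ->
    exists2 t, 0 <= t & N (t *: v + w) = t * N v + d.
  move=> wd; have [t0 /(_ t0 (lexx _)) [tge sub]] := norming_perturb v w.
  exists t0 => //; have [j Hj] := phi_attained (t0 *: v + w).
  have jF : j \in norming v by apply: (fintype.subsetP sub); apply/normingP.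
  by rewrite -Hj dotDl dotZl wd // (normingP _ _ jF).
apply/le_anti/andP; split.
  have [t t0 Nt] := far (p - x) c pc.
  have := le_trans (phi_le i _) (Hf p (x + (- t) *: v)).
  rewrite (_ : p - (x + _) = t *: v + (p - x)); last first.
    by apply/rowP => j; rewrite !mxE; ring.
  by rewrite Nt !dotBl rig // dotDl dotZl Nv; lra.
have [|t t0 Nt] := far (x - p) (- c).
  by move=> j jF; rewrite -opprB dotNl pc.
have := le_trans (phi_le i _) (Hf (x + t *: v) p).
rewrite (_ : x + _ - p = t *: v + (x - p)); last first.
  by apply/rowP => j; rewrite !mxE; ring.
by rewrite Nt !dotBl rig // dotDl dotZl Nv; lra.
Qed.

Lemma retraction_level Rf x v p c : is_limit_retraction N f Rf -> rigid_along x v ->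
  (forall i, i \in norming v -> dot (p - x) (phi i) = c) ->
  forall i, i \in norming v -> dot (Rf p - x) (phi i) = c.
Proof.
move=> HR rig pc.
have it k i : i \in norming v -> dot (iter k (avg_map f) p - x) (phi i) = c.
  elim: k i => [|k IH] i iF; first exact: pc.
  have := rigid_along_level rig IH iF; have := IH i iF.
  rewrite iterS /avg_map !dotBl dotDl !dotZl; lra.
move=> i iF; rewrite dotBl.
have h1 : dot (Rf p) (phi i) <= c + dot x (phi i).
  apply: (retraction_le HN HR (phi := fun y => dot y (phi i))) => [y z|k].
    by rewrite -dotBl.
  by have := it k i iF; rewrite dotBl; lra.
have h2 : - dot (Rf p) (phi i) <= - (c + dot x (phi i)).
  apply: (retraction_le HN HR (phi := fun y => - dot y (phi i))) => [y z|k].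
    by rewrite (norm_distC HN) opprK addrC -dotBl.
  by have := it k i iF; rewrite dotBl; lra.
lra.
Qed.

(** One fixed point and rigidity are asked for, rather than two fixed points: the minimality
    argument joins a fixed point to a far point of a rigid line. *)
Definition good_face (F : {set 'I_m}) :=
  exists x v, [/\ Fix f x, F = norming v & rigid_along x v].

Definition min_face F :=
  good_face F /\ forall F', good_face F' -> F' \subset F -> F' = F.

Lemma good_face_Fix x y : Fix f x -> Fix f y -> good_face (norming (y - x)).
Proof.
move=> fx fy; exists x, (y - x); split => //.
by apply: rigid_along_pair => i _; rewrite ?fx ?fy.
Qed.

Lemma exists_min_face F : good_face F -> exists2 F', min_face F' & F' \subset F.
Proof.
have [k] := ubnP #|F|; elim: k F => // k IH F Fk gF.
have [mF|] := pselect (min_face F); first by exists F.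
move=> /not_andP[//|/existsNP[F' /not_implyP[gF' /not_implyP[sF' neF']]]].
have [|F'' mF'' sF''] := IH F' _ gF'.
  apply: leq_trans (_ : #|F'| < #|F|)%N Fk.
  by apply: proper_card; rewrite finset.properEneq sF' andbT; apply/eqP.
by exists F'' => //; exact: fintype.subset_trans sF'' sF'.
Qed.

(** Join [z] to [x + t *: v] with [t] large. This line is rigid and its norming set lies in [F], so
    it is [F] by minimality. Hence all indices in [F] agree on [x + t *: v - z] and on [v], and so
    on [z - x]. *)
Lemma min_face_level F x v z : min_face F -> F = norming v -> Fix f x ->
  rigid_along x v -> Fix f z ->
  forall i j, i \in F -> j \in F -> dot (z - x) (phi i) = dot (z - x) (phi j).
Proof.
move=> [gF minF] Fv fx rig fz i j iF jF.
have [t /(_ t (lexx _)) [t0 sub]] := norming_perturb v (x - z).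
have wE : t *: v + (x - z) = x + t *: v - z by rewrite addrA [t *: v + x]addrC.
have gF' : good_face (norming (x + t *: v - z)).
  exists z, (x + t *: v - z); split => //.
  apply: rigid_along_pair => [l _|l]; first by rewrite fz.
  by rewrite -wE => /(fintype.subsetP sub) lv; exact: rig.
have FF : norming (x + t *: v - z) = F by apply: minF; rewrite // Fv -wE.
have Ht l : l \in F -> dot (z - x) (phi l) = t * N v - N (x + t *: v - z).
  move=> lF; have : l \in norming v by rewrite -Fv.
  move: lF; rewrite -{1}FF => /normingP <- /normingP <-.
  by rewrite !dotBl dotDl dotZl; ring.
by rewrite !Ht.
Qed.

End Faces.

(** * The space L and the construction of W *)

(** Writing the kernel as the row space of a square matrix makes ['rV[R]_n] a parameter space for
    L. *)
Lemma common_kernel (R : realType) n (s : seq 'cV[R]_n) : exists P : 'M[R]_n,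
  (forall u a, a \in s -> dot (u *m P) a = 0) /\
  (forall v, (forall a, a \in s -> dot v a = 0) -> exists u, v = u *m P).
Proof.
pose B := \matrix_(i < n, j < size s) tnth (in_tuple s) j i 0.
have BE (v : 'rV[R]_n) j : (v *m B) 0 j = dot v (tnth (in_tuple s) j).
  by rewrite dotE mxE; apply: eq_bigr => i _; rewrite mxE.
exists (kermx B); split => [u a|v Hv].
  move=> as_; have /tnthP[j ->] : a \in in_tuple s by [].
  by rewrite -BE -mulmxA mulmx_ker mulmx0 mxE.
apply/submxP/sub_kermxP/rowP => j; rewrite BE Hv ?mxE //.
exact: (mem_tnth j (in_tuple s)).
Qed.

Theorem theorem2p1 (R : realType) (n : nat) (N : 'rV[R]_n -> R)
    (f : 'rV[R]_n -> 'rV[R]_n) :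
  polyhedral_norm N ->
  nonexpansive N f ->
  real_analytic f ->
  (exists x0, Fix f x0) ->
  (exists Rf, is_limit_retraction N f Rf) /\
  (forall Rf, is_limit_retraction N f Rf ->
     exists W : 'rV[R]_n -> Prop,
       affine_subspace W /\ isometry_onto_Fix N f Rf W).
Proof.
move=> pN Hf Af [x0 fx0]; have HN : is_norm N by case: pN.
split; first exact: limit_retraction_exists fx0.
move=> Rf HR; have [m [phi [phi_le phi_att]]] := polyhedral_functionals HN pN.
pose mface F := min_face N f phi F.
pose inS i := exists2 F, mface F & i \in F.
pose pairs := [seq ij <- enum {: 'I_m * 'I_m} |
  `[< exists2 F, mface F & ij.1 \in F /\ ij.2 \in F >]].
have [P [PL LP]] := common_kernel [seq phi ij.1 - phi ij.2 | ij <- pairs].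
pose Leq v := forall F i j, mface F -> i \in F -> j \in F ->
  dot v (phi i) = dot v (phi j).
have Leq_P u : Leq (u *m P).
  move=> F i j mF iF jF; apply/eqP; rewrite -subr_eq0 -dotNr -dotDr; apply/eqP/PL.
  apply/mapP; exists (i, j) => //; rewrite mem_filter mem_enum andbT.
  by apply/asboolP; exists F.
have P_Leq v : Leq v -> exists u, v = u *m P.
  move=> Lv; apply: LP => a /mapP[[i j]]; rewrite mem_filter => /andP[/asboolP].
  by move=> [F mF [iF jF]] _ ->; rewrite dotDr dotNr (Lv F i j mF iF jF) subrr.
have Leq_Fix z : Fix f z -> Leq (z - x0).
  move=> fz F i j mF iF jF; have [[x [v [fx Fv rig]]] _] := mF.
  have := min_face_level HN Hf Af phi_le mF Fv fx rig fz iF jF.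
  have := min_face_level HN Hf Af phi_le mF Fv fx rig fx0 iF jF.
  by rewrite !dotBl; lra.
(* Both [x0 - x] and [w] have constant level on [F], so [x0 + w] lies in a level set that the
   retraction respects. *)
have RS w i : Leq w -> inS i -> dot (Rf (x0 + w)) (phi i) = dot (x0 + w) (phi i).
  move=> Lw [F mF iF]; have [[x [v [fx Fv rig]]] _] := mF.
  have : dot (Rf (x0 + w) - x) (phi i) = dot (x0 + w - x) (phi i).
    apply: (retraction_level HN Hf phi_le phi_att HR rig); last by rewrite -Fv.
    move=> j; rewrite -Fv => jF.
    have := min_face_level HN Hf Af phi_le mF Fv fx rig fx0 iF jF.
    by have := Lw F i j mF iF jF; rewrite !dotBl !dotDl; lra.
  by rewrite !dotBl; lra.
(* The norming set of [p - q] contains a minimal one, which is nonempty because the norm of [v] is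
   attained. *)
have NS p q : Fix f p -> Fix f q -> exists2 i, inS i & dot (p - q) (phi i) = N (p - q).
  move=> fp fq.
  have [F mF sF] := exists_min_face (good_face_Fix HN Hf Af phi_le fq fp).
  have [[x [v [_ Fv _]]] _] := mF; have [i Hi] := phi_att v.
  have iF : i \in F by rewrite Fv; apply/normingP.
  by exists i; [exists F | apply/normingP/(fintype.subsetP sF)].
have RF := retraction_Fix HN Hf HR.
(* The maximum over S, pulled back from L by [P]; starting it at [0] makes it a nonnegative
   gauge. *)
pose Q u := \big[Num.max/0]_(i | `[< inS i >]) dot (u *m P) (phi i).
have QS u i : inS i -> dot (u *m P) (phi i) <= Q u.
  by move=> Si; apply: (le_bigmax_cond _ (fun i => dot (u *m P) (phi i))); apply/asboolP.
have Qle u c : 0 <= c -> (forall i, inS i -> dot (u *m P) (phi i) <= c) -> Q u <= c.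
  by move=> c0 H; apply: bigmax_le => // i /asboolP; exact: H.
have Q0 u : 0 <= Q u by exact: bigmax_ge_id.
have QZ t u : 0 <= t -> Q (t *: u) = t * Q u.
  rewrite le_eqVlt => /orP[/eqP <-|t0].
    rewrite mul0r scale0r; apply/le_anti; rewrite Q0 andbT.
    by apply: Qle => // i _; rewrite mul0mx dot0l.
  apply/le_anti/andP; split.
    apply: Qle => [|i Si]; first by rewrite mulr_ge0 // ltW.
    by rewrite -scalemxAl dotZl ler_pM2l // QS.
  rewrite -ler_pdivlMl //; apply: Qle => [|i Si]; first by rewrite mulr_ge0 // invr_ge0 ltW.
  by rewrite ler_pdivlMl // -dotZl scalemxAl QS.
have QD u v : Q (u + v) <= Q u + Q v.
  apply: Qle => [|i Si]; first by rewrite addr_ge0.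
  by rewrite mulmxDl dotDl lerD // QS.
pose A a := exists2 i, inS i & a = phi i.
have sL : lifting N P A Q (fun u => Rf (x0 + u *m P)).
  have H u v i : inS i ->
      dot (Rf (x0 + u *m P) - Rf (x0 + v *m P)) (phi i) = dot ((u - v) *m P) (phi i).
    by move=> Si; rewrite dotBl !RS // -dotBl opprD addrACA subrr add0r mulmxBl.
  split=> [u v|a [i Si ->] u v]; last exact: H.
  have [i Si <-] := NS _ _ (RF (x0 + u *m P)) (RF (x0 + v *m P)).
  by rewrite H // QS.
have [T [TQ TA]] := lifting_linear HN Q0 QZ QD sL.
have TP u i : inS i -> dot (u *m T) (phi i) = dot (u *m P) (phi i).
  by move=> Si; rewrite /dot -!mulmxA TA //; exists i.
have Leq_T u : Leq (u *m T).
  move=> F i j mF iF jF; rewrite !TP; [|by exists F..].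
  exact: Leq_P mF iF jF.
(* [T] takes values in L by [Leq_T], so the retraction preserves the functionals of S on this
   set. *)
exists (fun w => exists u, w = x0 + u *m T); split.
  move=> _ _ t [u ->] [v ->]; exists (t *: u + (1 - t) *: v).
  rewrite mulmxDl -!scalemxAl; apply/rowP => j; rewrite !mxE; ring.
split => [w _|_ _ [u ->] [v ->]|z fz]; first exact: RF.
  apply/le_anti; rewrite (retraction_nonexpansive HN Hf HR) /=.
  (* For the reverse inequality, [N ((u - v) *m T) <= Q (u - v)], and each functional of S takes the
     same value on the difference of the images. *)
  rewrite opprD addrACA subrr add0r -mulmxBl; apply: le_trans (TQ _) _.
  apply: Qle => [|i Si]; first exact: norm_ge0.
  rewrite -TP // mulmxBl.
  have := phi_le i (Rf (x0 + u *m T) - Rf (x0 + v *m T)).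
  by rewrite !dotBl !RS // !dotDl; lra.
(* Both [z] and the image of [x0 + u *m T] are fixed and agree under S, which computes [N] on
   differences of fixed points. *)
have [u zu] := P_Leq _ (Leq_Fix z fz).
exists (x0 + u *m T); first by exists u.
apply/eqP; rewrite -subr_eq0; apply/eqP/(norm_eq0 HN).
have [i Si <-] := NS _ _ (RF (x0 + u *m T)) fz.
rewrite dotBl RS // dotDl TP // -zu dotBl; lra.
Qed.
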